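(* Let $X$ be a Priestley topological algebra of type $\tau$ and let $B$ be its dual residuation algebra. Then the Priestley topological algebra quotients of $X$ are in one-to-one correspondence with the residuation ideals of $B$. Explicitly, assigning to a quotient $\varphi:X\twoheadrightarrow Y$ the set $\{\varphi^{-1}(V)\mid V\text{ a clopen down-set of }Y\}$ yields a bijection between the Priestley topological algebra quotients of $X$ (up to isomorphism under $X$) and the residuation ideals of $B$.
   Context: A Priestley space is a compact ordered topological space that is totally order disconnected: whenever $x\nleq y$ there is a clopen down-set $U$ with $y\in U$ and $x\notin U$. A Priestley topological algebra of type $\tau$ is a Priestley space with an algebra structure of type $\tau$ whose basic operations are continuous and order preserving. Morphisms are continuous order-preserving algebra homomorphisms; isomorphisms are in addition homeomorphisms and order isomorphisms. A Priestley topological algebra quotient of $X$ is a surjective morphism $\varphi:X\twoheadrightarrow Y$ onto a Priestley topological algebra of type $\tau$; two quotients $\varphi:X\twoheadrightarrow Y$ and $\varphi':X\twoheadrightarrow Y'$ are identified if there is an isomorphism $\iota:Y\to Y'$ with $\iota\circ\varphi=\varphi'$. The residuation algebra $B$ dual to $X$ is the lattice of clopen down-sets of $X$ with, for each $n$-ary basic operation $f$ and each $1\leq i\leq n$, the operation $$f_i^\sharp(U_1,\ldots,U_{i-1},U_{i+1},\ldots,U_n,V)=\{x\in X\mid \forall x_j\in U_j\ (j\neq i):\ f(x_1,\ldots,x_{i-1},x,x_{i+1},\ldots,x_n)\in V\}.$$ (In the binary case, $U\backslash V=\{y\mid\forall x\in U,\ x\cdot y\in V\}$ and $V/U=\{x\mid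 \forall y\in U,\ x\cdot y\in V\}$.) A residuation ideal of $B$ is a subset $C\subseteq B$ that is a bounded sublattice of $B$ (containing $0$ and $1$) and such that for all $c\in C$, all $b_j\in B$, every $n$-ary $f\in\tau$ and every $i$, $f_i^\sharp(b_1,\ldots,b_{i-1},b_{i+1},\ldots,b_n,c)\in C$ (in the binary case: $c/b\in C$ and $b\backslash c\in C$ for all $c\in C$, $b\in B$). *)

(* Defs.v *)
From HB Require Import structures.
From mathcomp Require Import all_boot all_order.
From mathcomp Require Import all_classical topology function_spaces.

Set Implicit Arguments.
Unset Strict Implicit.
Unset Printing Implicit Defensive.

Import Order.TTheory.

Local Open Scope order_scope.
Local Open Scope classical_set_scope.

Definition down_set {d} {T : porderType d} (U : set T) : Prop :=
  forall x y : T, x <= y -> U y -> U x.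

HB.mixin Record isPriestley d T & POrderedTopological d T := {
  priestley_compact : compact [set: T];
  priestley_separated : forall x y : T, ~~ (x <= y) ->
    exists U : set T, [/\ clopen U, down_set U, U y & ~ U x]
}.

#[short(type="priestleyType")]
HB.structure Definition Priestley d :=
  {T of POrderedTopological d T & isPriestley d T}.

Record signature := Signature {
  symbol :> Type;
  arity : symbol -> nat
}.

HB.mixin Record isPriestleyAlgebra (tau : signature) d T & Priestley d T := {
  op : forall f : tau, ('I_(arity f) -> T) -> T;
  op_continuous : forall f : tau,
    continuous (op f : {ptws 'I_(arity f) -> T} -> T);
  op_homo : forall (f : tau) (x y : 'I_(arity f) -> T),
    (forall j, x j <= y j) -> op f x <= op f y
}.

#[short(type="priestleyAlgType")]
HB.structure Definition PriestleyAlgebra (tau : signature) d :=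
  {T of Priestley d T & isPriestleyAlgebra tau d T}.

Arguments op {tau d s} f x : rename.

Definition priestley_morphism {tau : signature} {d d' : Order.disp_t}
    {X : priestleyAlgType tau d} {Y : priestleyAlgType tau d'}
    (phi : X -> Y) : Prop :=
  [/\ continuous phi,
      {homo phi : x y / x <= y} &
      forall (f : tau) (x : 'I_(arity f) -> X),
        phi (op f x) = op f (phi \o x)].

Definition priestley_isomorphism {tau : signature} {d d' : Order.disp_t}
    {X : priestleyAlgType tau d} {Y : priestleyAlgType tau d'}
    (phi : X -> Y) : Prop :=
  [/\ priestley_morphism phi,
      {mono phi : x y / x <= y} &
      exists psi : Y -> X, [/\ cancel phi psi, cancel psi phi & continuous psi]].

(* The display [d] only selects notations, so letting the codomain share that *)
(* of [X] loses no generality.                                                *)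
Record priestley_quotient {tau : signature} {d : Order.disp_t}
    (X : priestleyAlgType tau d) := PriestleyQuotient {
  quotient_codomain : priestleyAlgType tau d;
  quotient_map :> X -> quotient_codomain;
  quotient_morphism : priestley_morphism quotient_map;
  quotient_surjective :
    set_surj [set: X] [set: quotient_codomain] quotient_map
}.

Definition same_quotient {tau : signature} {d : Order.disp_t}
    {X : priestleyAlgType tau d} (phi phi' : priestley_quotient X) : Prop :=
  exists iota : quotient_codomain phi -> quotient_codomain phi',
    priestley_isomorphism iota /\ iota \o phi = phi'.

(* The carrier of the residuation algebra dual to [X], as a family of subsets *)
(* of [X]; its bounded lattice operations are set0, setT, intersection and    *)
(* union.                                                                     *)
Definition dual_algebra {d} (X : priestleyType d) : set (set X) :=
  [set U | clopen U /\ down_set U].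

Arguments dual_algebra {d} X U.

(* f_i^#(U_1, ..., U_(i-1), U_(i+1), ..., U_n, V): the entry [U i] of the     *)
(* family [U] is a dummy. As [x i] ranges over [X] and the remaining entries  *)
(* over the [U j], the argument tuple is given as a single [x].               *)
Definition residual {tau : signature} {d : Order.disp_t}
    {X : priestleyAlgType tau d} (f : tau) (i : 'I_(arity f))
    (U : 'I_(arity f) -> set X) (V : set X) : set X :=
  [set a | forall x : 'I_(arity f) -> X,
     x i = a -> (forall j, j != i -> U j (x j)) -> V (op f x)].

Definition residuation_ideal {tau : signature} {d : Order.disp_t}
    (X : priestleyAlgType tau d) (C : set (set X)) : Prop :=
  [/\ C `<=` dual_algebra X,
      C set0 /\ C [set: X],
      setI_closed C,
      setU_closed C &
      forall (f : tau) (i : 'I_(arity f)) (b : 'I_(arity f) -> set X)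
             (c : set X),
        (forall j, j != i -> dual_algebra X (b j)) -> C c ->
        C (residual i b c)].

Arguments residuation_ideal {tau d} X C.

Definition quotient_ideal {tau : signature} {d : Order.disp_t}
    {X : priestleyAlgType tau d} (phi : priestley_quotient X) : set (set X) :=
  [set phi @^-1` V | V in dual_algebra (quotient_codomain phi)].

(* Main.v *)
Require Import Defs.
From HB Require Import structures.
From mathcomp Require Import all_boot all_order.
From mathcomp Require Import all_classical topology function_spaces.

(** The correspondence is Priestley duality for quotients, enriched with
operations. A quotient phi of X and the lattice C of preimages of clopen
down-sets determine each other through the preorder
    x <=_C y  iff  every member of C that contains y contains x,
because total order disconnectedness of the codomain says precisely that
phi x <= phi y iff x <=_C y (quotient_le_ideal).

The lattice of a quotient is a residuation ideal because residuals may be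
formed in the codomain, with the arguments replaced by their images:
residual i b (phi^-1 V) = phi^-1 (residual i (phi b) V). The images phi b
are compact but need not be clopen, so the point is that residuals by compact
sets still preserve clopen down-sets (residual_dual_algebra); the complement
of such a residual is the projection of a compact set of tuples.

Two quotients with the same C induce the same preorder on X, so each factors
through the other by an order embedding; continuity is automatic because
surjections from a compact onto a Hausdorff space are topological quotient maps
(continuous_of_comp_surj).

Conversely, a residuation ideal C yields the order quotient of X by <=_C. The
operations descend to it provided that they are monotone for <=_C, and one
argument may be changed at a time. Suppose c in C contains f(z) with y in
position i. The principal down-sets of the other entries of z are mapped into
c too, and by compactness they can be enlarged to clopen down-sets b_j without
losing this (residual_witness). So y lies in the residual of c by the b_j,
which belongs to C by the ideal property; hence every x <=_C y lies in it as
well, and c contains f(z) with x in position i. Finally a compactness argument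
recovers C as all clopen sets that are down-closed for <=_C
(separating_sublattice), so the quotient built from C has C as its lattice. *)

Set Implicit Arguments.
Unset Strict Implicit.
Unset Printing Implicit Defensive.

Import Order.TTheory.

Local Open Scope order_scope.
Local Open Scope classical_set_scope.

(** * Compactness and products *)

(** The finite-subcover property as an induction principle: a property of sets
that passes to finite unions and to subsets, and that holds locally, holds on
compact sets. The sets whose complement in K has the property would otherwise
form a proper filter without cluster point in K. Unlike a subcover indexed by
a finite set, this form carries the witnesses of the property through the
unions. *)
Lemma compact_induction (T : topologicalType) (K : set T)
    (P : set T -> Prop) :
  compact K -> P set0 -> setU_closed P ->
  (forall A B, A `<=` B -> P B -> P A) ->
  (forall x, K x -> exists2 U, nbhs x U & P U) -> P K.
Proof.
move=> cK P0 PU PS PK; apply: contrapT => nPK.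
pose F : set_system T := [set A | P (K `\` A)].
have FF : ProperFilter F.
  split; first by rewrite /F /= setD0.
  split; first by rewrite /F /= setDT.
    by move=> A B FA FB; rewrite /F /= setDIr; exact: PU.
  by move=> A B AB; apply: PS => x [Kx nBx]; split => // /AB.
have [|x [Kx clFx]] := cK F FF; first by rewrite /F /= setDv.
have [U Ux PUx] := PK x Kx.
have FcU : F (~` U) by apply: PS PUx => y [_ /contrapT].
by have [y []] := clFx _ _ FcU Ux.
Qed.

Lemma closed_image_compact (S T : topologicalType) (g : S -> T) (F : set S) :
  compact [set: S] -> hausdorff_space T -> continuous g ->
  closed F -> closed (g @` F).
Proof.
move=> cS hT cg cF; apply: compact_closed => //; apply: continuous_compact.
  exact: continuous_subspaceT.
exact: subclosed_compact cS _.
Qed.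

(** The hypotheses on [g] make it a closed map, hence a topological quotient
map, so that continuity descends along it. This is what makes induced maps and
induced operations continuous without any further work, even on powers, where
a product of quotient maps is in general not a quotient map. *)
Lemma continuous_of_comp_surj (S T U : topologicalType) (g : S -> T)
    (h : T -> U) :
  compact [set: S] -> hausdorff_space T -> continuous g ->
  set_surj [set: S] [set: T] g -> continuous (h \o g) -> continuous h.
Proof.
move=> cS hT cg sg /continuous_closedP chg; apply/continuous_closedP => F cF.
suff -> : h @^-1` F = g @` ((h \o g) @^-1` F).
  by apply: closed_image_compact => //; exact: chg.
apply/seteqP; split => [y Fhy|_ [x Fx <-]] //.
by have [x _ gxy] := sg y I; exists x; rewrite //= gxy.
Qed.

Lemma ptws_continuous (S : topologicalType) (I : eqType) (T : topologicalType)
    (g : S -> {ptws I -> T}) :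
  (forall i, continuous (fun s => g s i)) -> continuous g.
Proof.
move=> cg s; apply/cvg_sup => i.
exact: (@continuous_comp_initial _ _ _ (fun f : I -> T => f i) g (cg i) s).
Qed.

Lemma ptws_eval_continuous (I : eqType) (T : topologicalType) (i : I) :
  continuous (fun x : {ptws I -> T} => x i).
Proof. exact: (@proj_continuous I (fun=> T) i). Qed.

Lemma ptws_comp_continuous (I : eqType) (S T : topologicalType) (g : S -> T) :
  continuous g ->
  continuous ((fun x => g \o x) : {ptws I -> S} -> {ptws I -> T}).
Proof.
move=> cg; apply: ptws_continuous => i x.
apply: (@continuous_comp _ _ _ (fun y : {ptws I -> S} => y i) g).
  exact: ptws_eval_continuous.
exact: cg.
Qed.

Lemma ptws_dfwith_continuous (I : eqType) (T : topologicalType)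
    (z : I -> T) (i : I) :
  continuous (dfwith z i : T -> {ptws I -> T}).
Proof. exact: (@dfwith_continuous I (fun=> T) z i). Qed.

Lemma ptws_compact (I : eqType) (T : topologicalType) (K : I -> set T) :
  (forall i, compact (K i)) ->
  compact ([set x | forall i, K i (x i)] : set {ptws I -> T}).
Proof. exact: (@tychonoff I (fun=> T) K). Qed.

Lemma ptws_compactT (I : eqType) (T : topologicalType) :
  compact [set: T] -> compact [set: {ptws I -> T}].
Proof.
move=> cT; have := @ptws_compact I T (fun=> setT) (fun=> cT).
by congr compact; apply/seteqP.
Qed.

Lemma ptws_hausdorff (I : eqType) (T : topologicalType) :
  hausdorff_space T -> hausdorff_space {ptws I -> T}.
Proof. by move=> hT; exact: (@hausdorff_product I (fun=> T)). Qed.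

(** * Clopen down-sets of Priestley spaces *)

Lemma priestley_hausdorff d (X : priestleyType d) : hausdorff_space X.
Proof.
have sep p q (U : set X) : clopen U -> U p -> cluster (nbhs p) q -> U q.
  move=> [oU cU] Up pq; apply: cU => V Vq; apply: pq => //.
  exact: open_nbhs_nbhs.
move=> p q pq; apply: le_anti; apply/andP; split; apply: contrapT => /negP npq.
  have [U [cU _ Uq nUp]] := priestley_separated _ _ npq.
  exact: (sep _ _ _ (clopenC [set: X] cU) nUp pq).
have [U [cU _ Up nUq]] := priestley_separated _ _ npq.
exact/nUq/(sep _ _ _ cU Up pq).
Qed.

Section dual_algebra.
Context {d : Order.disp_t} {X : priestleyType d}.
Implicit Types (U V : set X).

Lemma dual_algebra0 : dual_algebra X set0.
Proof. by split; first exact: clopen0. Qed.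

Lemma dual_algebraT : dual_algebra X setT.
Proof. by split; first exact: clopenT. Qed.

Lemma dual_algebraI : setI_closed (dual_algebra X).
Proof.
move=> U V [cU dU] [cV dV]; split; first exact: clopenI.
by move=> x y xy [Uy Vy]; split; [exact: dU xy Uy|exact: dV xy Vy].
Qed.

Lemma dual_algebraU : setU_closed (dual_algebra X).
Proof.
move=> U V [cU dU] [cV dV]; split; first exact: clopenU.
by move=> x y xy [Uy|Vy]; [left; exact: dU xy Uy|right; exact: dV xy Vy].
Qed.

Lemma le_dual_algebraP (x y : X) :
  x <= y <-> forall U, dual_algebra X U -> U y -> U x.
Proof.
split=> [xy U [_ dU]|h]; first exact: dU xy.
apply: contrapT => /negP /priestley_separated [U [cU dU Uy nUx]].
by apply: nUx; exact: h Uy.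
Qed.

End dual_algebra.

Lemma preimage_dual_algebra d d' (X : priestleyType d) (Y : priestleyType d')
    (g : X -> Y) (V : set Y) :
  continuous g -> {homo g : x y / x <= y} ->
  dual_algebra Y V -> dual_algebra X (g @^-1` V).
Proof.
move=> cg hg [cV dV]; split; first exact: preimage_clopen.
by move=> x y xy; exact: dV (hg _ _ xy).
Qed.

(** A finite-union-of-finite-intersections argument: for fixed x in U,
compactness of the complement of U gives a member of C between x and U;
compactness of U then gives a union of those that equals U. *)
Lemma separating_sublattice (T : topologicalType) (C : set (set T))
    (U : set T) :
  compact [set: T] -> (forall c, C c -> clopen c) ->
  C set0 -> C setT -> setI_closed C -> setU_closed C ->
  clopen U ->
  (forall x y, U x -> ~ U y -> exists2 c, C c & c x /\ ~ c y) -> C U.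
Proof.
move=> cT Ccl C0 C1 CI CU [oU cU] sep.
have inner x : U x -> exists2 c, C c & c x /\ c `<=` U.
  move=> Ux.
  suff [c Cc [cx cU0]] : exists2 c, C c & c x /\ c `&` ~` U `<=` set0.
    exists c => //; split => // y cy; apply: contrapT => nUy.
    exact: cU0 (conj cy nUy).
  apply: (@compact_induction _ (~` U)
    (fun W => exists2 c, C c & c x /\ c `&` W `<=` set0)).
  - by apply: subclosed_compact cT _ => //; exact: open_closedC.
  - by exists setT => //; split => // y [].
  - move=> A B [a Ca [ax aA]] [b Cb [bx bB]]; exists (a `&` b); first exact: CI.
    by split => // y [[ay by_] [Ay|By]]; [exact: aA (conj ay Ay)|
       exact: bB (conj by_ By)].
  - move=> A B AB [c Cc [cx cB]]; exists c => //; split => // y [cy Ay].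
    exact: cB (conj cy (AB _ Ay)).
  - move=> y nUy; have [c Cc [cx ncy]] := sep x y Ux nUy.
    exists (~` c); last by exists c => //; split => // z [].
    apply: open_nbhs_nbhs; split => //.
    by apply: closed_openC; have [] := Ccl c Cc.
suff [c Cc [cU' Uc]] : exists2 c, C c & c `<=` U /\ U `<=` c.
  by rewrite (_ : U = c) //; apply/seteqP.
apply: (@compact_induction _ U
  (fun W => exists2 c, C c & c `<=` U /\ W `<=` c)).
- exact: subclosed_compact cT _.
- by exists set0 => //; split => x [].
- move=> A B [a Ca [aU Aa]] [b Cb [bU Bb]]; exists (a `|` b); first exact: CU.
  by split; [rewrite subUset|exact: setUSS].
- move=> A B AB [c Cc [cU' Bc]]; exists c => //; split => //.
  exact: subset_trans AB Bc.
- move=> x Ux; have [c Cc [cx cU']] := inner x Ux.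
  exists c; last by exists c => //; split => // y.
  by apply: open_nbhs_nbhs; split => //; have [] := Ccl c Cc.
Qed.

(** * Residuals of clopen down-sets *)

Section residuals.
Context {tau : signature} {d : Order.disp_t} {X : priestleyAlgType tau d}.
Implicit Types (f : tau) (V : set X).

(** Openness needs compactness of the [K j]: the complement is the i-th
projection of the compact set of tuples with entries in the [K j] that the
operation maps outside [V]. For closedness, the residual is an intersection of preimages
of [V] under the maps that fix all entries but the i-th. Stated for compact rather than
clopen arguments so that it applies to images of clopen sets under a
quotient map. *)
Lemma residual_dual_algebra f (i : 'I_(arity f))
    (K : 'I_(arity f) -> set X) V :
  (forall j, j != i -> compact (K j)) -> dual_algebra X V ->
  dual_algebra X (residual i K V).
Proof.
move=> cK [[oV cV] dV]; split; first split.
(* The projected coordinate i itself is unconstrained. *)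
- pose K' j := if j == i then [set: X] else K j.
  have cK' j : compact (K' j).
    rewrite /K'; case: eqVneq => [_|/cK//].
    exact: priestley_compact.
  pose B : set {ptws 'I_(arity f) -> X} :=
    [set x | forall j, K' j (x j)] `&` op f @^-1` (~` V).
  have cB : compact B.
    apply: (@subclosed_compact {ptws 'I_(arity f) -> X} _
      [set x | forall j, K' j (x j)]).
    - apply: closedI.
        apply: compact_closed; last exact: ptws_compact.
        exact/ptws_hausdorff/priestley_hausdorff.
      apply: (preimage_closed _ (open_closedC oV)) => x _.
      exact: op_continuous.
    - exact: ptws_compact.
    - by move=> x [].
  rewrite -[residual i K V]setCK; apply: closed_openC.
  suff -> : ~` residual i K V = (fun x : {ptws 'I_(arity f) -> X} => x i) @` B.
    apply: compact_closed; first exact: priestley_hausdorff.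
    apply: continuous_compact => //; apply: continuous_subspaceT.
    exact: ptws_eval_continuous.
  apply/seteqP; split => [a na|_ [x [Kx nVx] <-] res].
    apply: contrapT => nB; apply: na => x xia xK; apply: contrapT => nVx.
    apply: nB; exists x => //; split => // j; rewrite /K'.
    by case: eqVneq => // /xK.
  apply: nVx; apply: res => // j ji; have := Kx j.
  by rewrite /K' (negPf ji).
- rewrite (_ : residual i K V = \bigcap_(z in [set z | forall j, j != i ->
      K j (z j)]) ((fun a => op f (dfwith z i a)) @^-1` V)).
    apply: closed_bigI => z _; apply: preimage_closed => // a _.
    apply: (@continuous_comp _ {ptws 'I_(arity f) -> X} _
      (dfwith z i) (op f)).
      exact: ptws_dfwith_continuous.
    exact: op_continuous.
  apply/seteqP; split => [a ra z Kz|a ra x xa Kx].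
    apply: ra; first exact: dfwithin.
    by move=> j ji; rewrite dfwithout 1?eq_sym //; exact: Kz.
  have := ra x Kx; rewrite /= (_ : dfwith x i a = x) //.
  by apply/funext => j; case: dfwithP.
- move=> a b ab rb x xa Kx.
  apply: (dV _ (op f (dfwith x i b))).
    by apply: op_homo => j; case: dfwithP => //; rewrite xa.
  apply: rb; first exact: dfwithin.
  by move=> j ji; rewrite dfwithout 1?eq_sym //; exact: Kx.
Qed.

End residuals.

(** * The residuation ideal of a quotient *)

Section quotients.
Context {tau : signature} {d : Order.disp_t} {X : priestleyAlgType tau d}.
Implicit Types (phi : priestley_quotient X) (C : set (set X)).

Lemma residuation_ideal_dual_algebra C c :
  residuation_ideal X C -> C c -> dual_algebra X c.
Proof. by case=> CB _ _ _ _; exact: CB. Qed.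

(** Residuals are formed in the codomain by the images [phi @` b j]. The
preimage is the right residual in [X] because a tuple whose i-th entry is
[phi a] and whose other entries lie in these images lifts by choice to a tuple
with i-th entry [a] and other entries in the [b j]. *)
Lemma quotient_ideal_residuation_ideal phi :
  residuation_ideal X (quotient_ideal phi).
Proof.
have [cphi hphi opphi] := quotient_morphism phi.
split.
- by move=> _ [V BV <-]; exact: preimage_dual_algebra.
- split; first by exists set0 => //; exact: dual_algebra0.
  by exists setT => //; exact: dual_algebraT.
- move=> _ _ [U BU <-] [V BV <-]; exists (U `&` V) => //.
  exact: dual_algebraI.
- move=> _ _ [U BU <-] [V BV <-]; exists (U `|` V) => //.
  exact: dual_algebraU.
- move=> f i b _ Bb [V BV <-]; exists (residual i (fun j => phi @` b j) V).
    apply: residual_dual_algebra => // j ji; apply: continuous_compact.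
      exact: continuous_subspaceT.
    have [[_ cb] _] := Bb j ji.
    exact: subclosed_compact cb (@priestley_compact _ X) _.
  apply/seteqP; split => a ra x.
    move=> xia bx; rewrite /= opphi; apply: ra => [|j ji].
      by rewrite /= xia.
    by exists (x j) => //; exact: bx.
  move=> xia bx.
  have /choice[w wP] : forall j, exists u, phi u = x j /\
      if j == i then u = a else b j u.
    by move=> j; case: eqVneq => [->|/bx[u]]; [exists a|exists u].
  have wi : w i = a by have [_] := wP i; rewrite eqxx.
  have -> : x = phi \o w by apply/funext => j /=; have [->] := wP j.
  rewrite -opphi; apply: (ra w wi) => j ji.
  by have [_] := wP j; rewrite (negPf ji).
Qed.

(** The ideal of a quotient remembers its order, hence also its kernel; this is
total order disconnectedness of the codomain. *)
Lemma quotient_le_ideal phi x y :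
  phi x <= phi y <-> forall c, quotient_ideal phi c -> c y -> c x.
Proof.
rewrite le_dual_algebraP; split => [h _ [V BV <-]|h V BV]; first exact: h.
by apply: (h (phi @^-1` V)); exists V.
Qed.

Lemma quotient_ideal_sub_of_factor phi phi'
    (g : quotient_codomain phi -> quotient_codomain phi') :
  continuous g -> {homo g : x y / x <= y} -> g \o phi = phi' ->
  quotient_ideal phi' `<=` quotient_ideal phi.
Proof.
move=> cg hg gphi _ [V BV <-]; exists (g @^-1` V); last by rewrite -gphi.
exact: preimage_dual_algebra.
Qed.

(** [phi] and [phi'] induce the same preorder on X, so [phi'] precomposed with
any section of [phi] is independent of the section, and continuity,
monotonicity and compatibility with the operations descend along [phi]. *)
Lemma quotient_factor phi phi' :
  quotient_ideal phi' = quotient_ideal phi ->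
  exists g : quotient_codomain phi -> quotient_codomain phi',
    [/\ priestley_morphism g, {mono g : x y / x <= y} & g \o phi = phi'].
Proof.
move=> eqC; have [cphi hphi opphi] := quotient_morphism phi.
have [cphi' hphi' opphi'] := quotient_morphism phi'.
have leE x y : (phi' x <= phi' y) = (phi x <= phi y).
  by apply/idP/idP => /quotient_le_ideal; [rewrite eqC|rewrite -eqC];
     move/quotient_le_ideal.
have /choice[s sK] : forall y, exists x, phi x = y.
  by move=> y; have [x _ <-] := @quotient_surjective _ _ _ phi y I; exists x.
have gphi : (phi' \o s) \o phi = phi'.
  apply/funext => x /=; apply: le_anti.
  by rewrite !leE sK lexx.
have mono : {mono phi' \o s : x y / x <= y}.
  by move=> x y; rewrite /= leE !sK.
exists (phi' \o s); split => //; split.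
- apply: (continuous_of_comp_surj (g := phi)) => //.
  + exact: priestley_compact.
  + exact: priestley_hausdorff.
  + exact: quotient_surjective.
  + by rewrite gphi.
- by move=> x y; rewrite mono.
- move=> f y; have -> : y = phi \o (s \o y) by apply/funext => j /=; rewrite sK.
  rewrite -opphi -[LHS]/(((phi' \o s) \o phi) _) gphi opphi'; congr op.
  by rewrite -[RHS]/(((phi' \o s) \o phi) \o (s \o y)) gphi.
Qed.

Lemma same_quotientP phi phi' :
  same_quotient phi phi' <-> quotient_ideal phi = quotient_ideal phi'.
Proof.
split=> [[g [[[cg hg _] mono [h [gK hK ch]]] gphi]]|eqC].
  apply/seteqP; split.
    apply: (quotient_ideal_sub_of_factor (g := h)) => //.
      by move=> x y xy; rewrite -mono !hK.
    by apply/funext => x; rewrite -gphi /= gK.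
  exact: (quotient_ideal_sub_of_factor (g := g)).
have [g [mg mono gphi]] := quotient_factor (esym eqC).
have [h [[ch _ _] _ hphi]] := quotient_factor eqC.
exists g; split => //; split => //; exists h; split => //.
- move=> y; have [x _ <-] := @quotient_surjective _ _ _ phi y I.
  by rewrite -[g _]/((g \o phi) x) gphi -[LHS]/((h \o phi') x) hphi.
- move=> y; have [x _ <-] := @quotient_surjective _ _ _ phi' y I.
  by rewrite -[h _]/((h \o phi') x) hphi -[LHS]/((g \o phi) x) gphi.
Qed.

End quotients.

(** * Operations preserve the preorder of a residuation ideal *)

Definition ideal_le (T : Type) (C : set (set T)) (x y : T) : Prop :=
  forall c, C c -> c y -> c x.

Lemma ideal_le_refl (T : Type) (C : set (set T)) x : ideal_le C x x.
Proof. by []. Qed.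

Lemma ideal_le_trans (T : Type) (C : set (set T)) y x z :
  ideal_le C x y -> ideal_le C y z -> ideal_le C x z.
Proof. by move=> xy yz c Cc /(yz c Cc); exact: xy. Qed.

Section compatibility.
Context {tau : signature} {d : Order.disp_t} {X : priestleyAlgType tau d}.

Lemma residual_dfwith (f : tau) (i : 'I_(arity f)) (b : 'I_(arity f) -> set X)
    (V : set X) (z : 'I_(arity f) -> X) (a : X) :
  residual i b V a -> (forall j, j != i -> b j (z j)) ->
  V (op f (dfwith z i a)).
Proof.
move=> + bz; apply; first exact: dfwithin.
by move=> j ji; rewrite dfwithout 1?eq_sym //; exact: bz.
Qed.

(** Continuity in the guise used here: membership of [f(z)] in a clopen down-set
is witnessed by clopen down-sets around the entries of [z]. As [f] is monotone,
a tuple with i-th entry [a] that is mapped outside [V] is not below [z] in some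
other coordinate, and a clopen down-set separates it from [z] there; compactness
of the set of these tuples leaves finitely many conditions per coordinate. *)
Lemma residual_witness (f : tau) (i : 'I_(arity f)) (V : set X)
    (z : 'I_(arity f) -> X) (a : X) :
  dual_algebra X V -> V (op f (dfwith z i a)) ->
  exists b, [/\ forall j, dual_algebra X (b j), forall j, b j (z j) &
    residual i b V a].
Proof.
move=> [[oV cV] dV] Vza.
pose bad : set {ptws 'I_(arity f) -> X} := [set x | x i = a /\ ~ V (op f x)].
have cbad : compact bad.
  apply: (@subclosed_compact {ptws 'I_(arity f) -> X} _ setT) => //; last first.
    exact/ptws_compactT/priestley_compact.
  apply: closedI.
    apply: (@preimage_closed _ _ (fun x : {ptws 'I_(arity f) -> X} => x i)
              [set a]).
      by move=> x _; exact: ptws_eval_continuous.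
    exact/accessible_closed_set1/hausdorff_accessible/priestley_hausdorff.
  apply: (preimage_closed _ (open_closedC oV)) => x _.
  exact: op_continuous.
pose avoidable (W : set {ptws 'I_(arity f) -> X}) :=
  exists b, [/\ forall j, dual_algebra X (b j), forall j, b j (z j) &
    forall x, W x -> exists2 j, j != i & ~ b j (x j)].
suff [b [Bb bz bW]] : avoidable bad.
  exists b; split => // x xia bx; apply: contrapT => nVx.
  by have [j ji] := bW x (conj xia nVx); apply; exact: bx.
apply: compact_induction cbad _ _ _ _.
- by exists (fun=> setT); split => // _; exact: dual_algebraT.
- move=> A B [a1 [Ba1 a1z a1A]] [a2 [Ba2 a2z a2B]].
  exists (fun j => a1 j `&` a2 j); split => //.
    by move=> j; exact: dual_algebraI.
  by move=> x [/a1A|/a2B] [j ji nj]; exists j => // -[].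
- move=> A B AB [b [Bb bz bB]]; exists b; split => // x /AB; exact: bB.
- move=> x [xia nVx].
  have [j ji nxz] : exists2 j, j != i & ~~ (x j <= z j).
    apply: contrapT => nj; apply: nVx; apply: dV Vza; apply: op_homo => j.
    case: dfwithP => [|{}j ij]; first by rewrite xia.
    apply: contrapT => /negP nxz; apply: nj; exists j => //.
    by rewrite eq_sym.
  have [U [cU dU Uz nUx]] := priestley_separated _ _ nxz.
  exists [set y | ~ U (y j)].
    apply: open_nbhs_nbhs; split => //.
    have [oU _] : clopen (~` U) by exact: (clopenC setT).
    by move/continuousP: (@ptws_eval_continuous 'I_(arity f) X j) => /(_ _ oU).
  exists (dfwith (fun=> setT) j U); split.
  + by move=> k; case: dfwithP => // *; exact: dual_algebraT.
  + by move=> k; case: dfwithP.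
  + by move=> y nUy; exists j => //; rewrite dfwithin.
Qed.

(** This is where the ideal property enters: the witnesses [b] are arbitrary
elements of the dual algebra, and it is the residual of [c] by them that must
lie in [C] for the hypothesis on [x] and [y] to apply. *)
Lemma op_ideal_le1 (C : set (set X)) (f : tau) (i : 'I_(arity f))
    (z : 'I_(arity f) -> X) (x y : X) :
  residuation_ideal X C -> ideal_le C x y ->
  ideal_le C (op f (dfwith z i x)) (op f (dfwith z i y)).
Proof.
move=> [CB _ _ _ Cres] xy c Cc cy.
have [b [Bb bz ry]] := residual_witness (CB c Cc) cy.
apply: residual_dfwith (fun j _ => bz j).
apply: xy ry; apply: Cres => // j _; exact: Bb.
Qed.

Lemma op_ideal_le (C : set (set X)) (f : tau) (w z : 'I_(arity f) -> X) :
  residuation_ideal X C -> (forall j, ideal_le C (w j) (z j)) ->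
  ideal_le C (op f w) (op f z).
Proof.
move=> idC wz.
(* Pass from z to w by replacing the entries in increasing order of index. *)
pose mix k := fun j : 'I_(arity f) => if (j < k)%N then w j else z j.
suff mixP k : (k <= arity f)%N -> ideal_le C (op f (mix k)) (op f z).
  have -> : w = mix (arity f) by apply/funext => j; rewrite /mix ltn_ord.
  exact: mixP.
elim: k => [_|k IHk ltkn].
  by have -> : mix 0%N = z by apply/funext => j; rewrite /mix ltn0.
apply: ideal_le_trans (IHk (ltnW ltkn)).
pose i := Ordinal ltkn.
have mixS : mix k.+1 = dfwith (mix k) i (w i).
  apply/funext => j; case: dfwithP => [|{}j ij]; first by rewrite /mix /= ltnSn.
  rewrite /mix ltnS leq_eqVlt; case: eqVneq => //= jk.
  by case/eqP: ij; exact/val_inj.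
have mixE : mix k = dfwith (mix k) i (z i).
  by apply/funext => j; case: dfwithP => //; rewrite /mix /= ltnn.
by rewrite mixS [X in ideal_le C _ (op f X)]mixE; exact: op_ideal_le1.
Qed.

End compatibility.

(** * The quotient by a residuation ideal *)

Section ideal_quotient.
Local Open Scope quotient_scope.
Context {tau : signature} {d : Order.disp_t} {X : priestleyAlgType tau d}.
Context (C : set (set X)) (idC : residuation_ideal X C).

Definition ideal_equiv (x y : X) : bool :=
  `[< ideal_le C x y /\ ideal_le C y x >].

Lemma ideal_equiv_refl : reflexive ideal_equiv.
Proof. by move=> x; apply/asboolP; split; exact: ideal_le_refl. Qed.

Lemma ideal_equiv_sym : symmetric ideal_equiv.
Proof. by move=> x y; apply/asboolP/asboolP => -[]. Qed.

Lemma ideal_equiv_trans : transitive ideal_equiv.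
Proof.
move=> y x z /asboolP[xy yx] /asboolP[yz zy]; apply/asboolP.
by split; exact: (@ideal_le_trans _ _ y).
Qed.

Canonical ideal_equiv_rel :=
  EquivRel ideal_equiv ideal_equiv_refl ideal_equiv_sym ideal_equiv_trans.

(** The proof that [C] is a residuation ideal is an argument of the carrier so
that the algebra structure, which depends on it, can be inferred from the
type. *)
Definition ideal_quotient of residuation_ideal X C :=
  quotient_topology {eq_quot ideal_equiv_rel}.

Local Notation Q := (ideal_quotient idC).

HB.instance Definition _ :=
  Topological.copy Q (quotient_topology {eq_quot ideal_equiv_rel}).

Definition ideal_pi : X -> Q := \pi_{eq_quot ideal_equiv_rel}.
Definition ideal_repr : Q -> X := @repr X {eq_quot ideal_equiv_rel}.

Lemma ideal_reprK : cancel ideal_repr ideal_pi.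
Proof. by move=> a; exact: (@reprK X {eq_quot ideal_equiv_rel}). Qed.

Lemma ideal_pi_continuous : continuous ideal_pi.
Proof. exact: (@pi_continuous X {eq_quot ideal_equiv_rel}). Qed.

Lemma ideal_pi_surj : set_surj [set: X] [set: Q] ideal_pi.
Proof. by move=> a _; exists (ideal_repr a) => //; exact: ideal_reprK. Qed.

Lemma ideal_pi_eqP (x y : X) :
  ideal_pi x = ideal_pi y <-> ideal_le C x y /\ ideal_le C y x.
Proof.
split=> [xy|xy]; last by apply/(@eqmodP X ideal_equiv_rel)/asboolP.
by apply/asboolP; exact/(@eqmodP X ideal_equiv_rel).
Qed.

Lemma ideal_repr_pi (x : X) :
  ideal_le C (ideal_repr (ideal_pi x)) x /\
  ideal_le C x (ideal_repr (ideal_pi x)).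
Proof. by apply/ideal_pi_eqP; rewrite ideal_reprK. Qed.

Definition ideal_quotient_le (a b : Q) : bool :=
  `[< ideal_le C (ideal_repr a) (ideal_repr b) >].

Lemma ideal_quotient_le_refl : reflexive ideal_quotient_le.
Proof. by move=> a; apply/asboolP; exact: ideal_le_refl. Qed.

Lemma ideal_quotient_le_anti : antisymmetric ideal_quotient_le.
Proof.
move=> a b /andP[/asboolP ab /asboolP ba].
by rewrite -[a]ideal_reprK -[b]ideal_reprK; apply/ideal_pi_eqP.
Qed.

Lemma ideal_quotient_le_trans : transitive ideal_quotient_le.
Proof.
move=> b a c /asboolP ab /asboolP bc; apply/asboolP.
exact: ideal_le_trans ab bc.
Qed.

HB.instance Definition _ := Order.Le_isPOrder.Build d Q
  ideal_quotient_le_refl ideal_quotient_le_anti ideal_quotient_le_trans.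

Lemma ideal_pi_le (x y : X) : ideal_pi x <= ideal_pi y <-> ideal_le C x y.
Proof.
have [rx xr] := ideal_repr_pi x; have [ry yr] := ideal_repr_pi y.
split=> [/asboolP h|h]; last apply/asboolP.
  exact: ideal_le_trans xr (ideal_le_trans h ry).
exact: ideal_le_trans rx (ideal_le_trans h yr).
Qed.

Lemma ideal_pi_homo : {homo ideal_pi : x y / x <= y}.
Proof.
move=> x y xy; apply/ideal_pi_le => c Cc.
by have [_ dc] := residuation_ideal_dual_algebra idC Cc; exact: dc.
Qed.

Lemma ideal_pi_preimage_image c :
  C c -> ideal_pi @^-1` (ideal_pi @` c) = c.
Proof.
move=> Cc; apply/seteqP; split=> [x [y cy yx]|x cx]; last by exists x.
by have /ideal_pi_eqP[_] := yx; exact.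
Qed.

Lemma ideal_pi_clopen (V : set Q) : clopen (ideal_pi @^-1` V) -> clopen V.
Proof.
case=> oV; rewrite -openC => oVC; split; first exact: oV.
by rewrite -openC; exact: oVC.
Qed.

Lemma ideal_pi_image_dual_algebra c : C c ->
  clopen (ideal_pi @` c) /\ down_set (ideal_pi @` c).
Proof.
move=> Cc; have [clc dc] := residuation_ideal_dual_algebra idC Cc; split.
  by apply: ideal_pi_clopen; rewrite ideal_pi_preimage_image.
move=> a b + [y cy yb]; rewrite -(ideal_reprK a) -yb => /ideal_pi_le h.
by exists (ideal_repr a) => //; exact: h cy.
Qed.

Lemma ideal_quotient_compact : compact [set: Q].
Proof.
rewrite (_ : setT = ideal_pi @` setT).
  apply: continuous_compact; last exact: priestley_compact.
  exact/continuous_subspaceT/ideal_pi_continuous.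
by apply/seteqP; split => // a _; exact: ideal_pi_surj.
Qed.

Lemma ideal_quotient_separated (a b : Q) : ~~ (a <= b) ->
  exists U : set Q, [/\ clopen U, down_set U, U b & ~ U a].
Proof.
rewrite -(ideal_reprK a) -(ideal_reprK b) => /negP nab.
have [c [Cc cb nca]] : exists c, [/\ C c, c (ideal_repr b) &
    ~ c (ideal_repr a)].
  apply: contrapT => nc; apply/nab/ideal_pi_le => c Cc cb.
  by apply: contrapT => nca; apply: nc; exists c.
have [clc dc] := ideal_pi_image_dual_algebra Cc.
exists (ideal_pi @` c); split => //.
by rewrite -[X in ~ X]/((ideal_pi @^-1` (ideal_pi @` c)) (ideal_repr a))
  ideal_pi_preimage_image.
Qed.

HB.instance Definition _ := isPriestley.Build d Q
  ideal_quotient_compact ideal_quotient_separated.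

Definition ideal_quotient_op (f : tau) (a : 'I_(arity f) -> Q) : Q :=
  ideal_pi (op f (ideal_repr \o a)).

Lemma ideal_pi_op (f : tau) (x : 'I_(arity f) -> X) :
  ideal_pi (op f x) = ideal_quotient_op (ideal_pi \o x).
Proof.
by apply/ideal_pi_eqP; split; apply: op_ideal_le => // j;
  have [] := ideal_repr_pi (x j).
Qed.

(** The power of the projection is a surjection from a compact space onto a
Hausdorff space, so continuity is inherited from the operation of [X]. *)
Lemma ideal_quotient_op_continuous (f : tau) :
  continuous (ideal_quotient_op (f := f) : {ptws 'I_(arity f) -> Q} -> Q).
Proof.
apply: (@continuous_of_comp_surj {ptws 'I_(arity f) -> X}
  {ptws 'I_(arity f) -> Q} _ (fun x => ideal_pi \o x)).
- exact/ptws_compactT/priestley_compact.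
- exact/ptws_hausdorff/priestley_hausdorff.
- exact/ptws_comp_continuous/ideal_pi_continuous.
- move=> a _; exists (ideal_repr \o a) => //.
  by apply/funext => j; exact: ideal_reprK.
- rewrite (_ : _ \o _ = ideal_pi \o op f); last first.
    by apply/funext => x; rewrite /= ideal_pi_op.
  move=> x; apply: (@continuous_comp {ptws 'I_(arity f) -> X}).
    exact: op_continuous.
  exact: ideal_pi_continuous.
Qed.

Lemma ideal_quotient_op_homo (f : tau) (a b : 'I_(arity f) -> Q) :
  (forall j, a j <= b j) -> ideal_quotient_op a <= ideal_quotient_op b.
Proof.
move=> ab; apply/ideal_pi_le; apply: op_ideal_le => // j.
by apply/ideal_pi_le; rewrite !ideal_reprK.
Qed.

HB.instance Definition _ := isPriestleyAlgebra.Build tau d Q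
  ideal_quotient_op_continuous ideal_quotient_op_homo.

Lemma ideal_pi_morphism : priestley_morphism (ideal_pi : X -> Q).
Proof.
split; [exact: ideal_pi_continuous|exact: ideal_pi_homo|exact: ideal_pi_op].
Qed.

Definition quotient_of_ideal : priestley_quotient X :=
  PriestleyQuotient ideal_pi_morphism ideal_pi_surj.

(** The preimage of a clopen down-set is closed downwards for [ideal_le C], so
any two points that it separates are already separated by a member of [C]. *)
Lemma quotient_of_idealK : quotient_ideal quotient_of_ideal = C.
Proof.
have [CB [C0 C1] CI CU _] := idC.
apply/seteqP; split=> [_ [V [clV dV] <-]|c Cc]; last first.
  exists (ideal_pi @` c); first exact: ideal_pi_image_dual_algebra.
  exact: ideal_pi_preimage_image.
apply: separating_sublattice => //.
- exact: priestley_compact.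
- by move=> c /CB[].
- exact: preimage_clopen clV ideal_pi_continuous.
- move=> x y Vx nVy; apply: contrapT => nc; apply: nVy.
  apply: dV Vx; apply/ideal_pi_le => c Cc cx.
  by apply: contrapT => ncy; apply: nc; exists c.
Qed.

End ideal_quotient.

Theorem theorem3p29 (tau : signature) (d : Order.disp_t)
    (X : priestleyAlgType tau d) :
  [/\ (* the assignment takes values in the residuation ideals *)
      forall phi : priestley_quotient X,
        residuation_ideal X (quotient_ideal phi),
      (* it is well defined and injective on quotients up to isomorphism *)
      forall phi phi' : priestley_quotient X,
        same_quotient phi phi' <-> quotient_ideal phi = quotient_ideal phi' &
      (* it is surjective *)
      forall C : set (set X), residuation_ideal X C ->
        exists phi : priestley_quotient X, quotient_ideal phi = C].
Proof.
split; first exact: quotient_ideal_residuation_ideal.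
  exact: same_quotientP.
by move=> C idC; exists (quotient_of_ideal idC); exact: quotient_of_idealK.
Qed.
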